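(* Let $\alpha$ be an infinite ordinal and let $\mathbf L=\{\mathfrak A\in\mathbf{RCA}_{\alpha+\omega}:\mathfrak A=\mathfrak{Sg}^{\mathfrak A}\mathfrak{Nr}_\alpha\mathfrak A\}$. Then the neat reduct functor $\mathfrak{Nr}_\alpha:\mathbf L\to\mathbf{RCA}_\alpha$, where in both categories the morphisms are the injective homomorphisms, does not have an adjoint (called a right adjoint in the paper), in the sense that it is not the case that every $\mathfrak B\in\mathbf{RCA}_\alpha$ has an $\mathfrak{Nr}_\alpha$-universal map.
   Context: $\mathbf{CA}_\beta$ is the class of cylindric algebras of dimension $\beta$ (Henkin–Monk–Tarski). $\mathbf{RCA}_\beta$ is the class of representable ones: algebras isomorphic to subdirect products of subalgebras of full cylindric set algebras $\wp({}^\beta U)$. For $\alpha<\beta$ and $\mathfrak A\in\mathbf{CA}_\beta$, $\mathfrak{Nr}_\alpha\mathfrak A\in\mathbf{CA}_\alpha$ has universe $\{x\in A:\mathsf c_ix=x\text{ for all }i\in\beta\setminus\alpha\}$ and the operations of $\mathfrak A$ with indices in $\alpha$; on morphisms, $\mathfrak{Nr}_\alpha$ acts by restriction. $\mathfrak{Sg}^{\mathfrak A}X$ is the subalgebra of $\mathfrak A$ generated by $X$. Universal maps: for a functor $G:K\to L$ and $\mathfrak B\in Ob(L)$, a $G$-universal map for $\mathfrak B$ is a pair $(u_B,\mathfrak A_B)$ with $\mathfrak A_B\in Ob(K)$ and $u_B:\mathfrak B\to G(\mathfrak A_B)$ an $L$-morphism such that for each $\mathfrak A'\in Ob(K)$ and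 each $L$-morphism $f:\mathfrak B\to G(\mathfrak A')$ there is a unique $K$-morphism $\bar f:\mathfrak A_B\to\mathfrak A'$ with $G(\bar f)\circ u_B=f$. Every object of $L$ has a $G$-universal map if and only if there is an adjoint situation $(\mu,\epsilon):F\to G$ with $F:L\to K$. *)

(* Defs.v *)
From HB Require Import structures.
From mathcomp Require Import all_boot all_order.
From mathcomp Require Import boolp classical_sets functions cardinality.
From mathcomp Require Import wochoice.

Set Implicit Arguments.
Unset Strict Implicit.
Unset Printing Implicit Defensive.

Import Order.Theory.
Import SetOrder.Exports.
Local Open Scope order_scope.

(* Ordinals are given by well-ordered types; the dimension of a cylindric     *)
(* algebra is the underlying set of an ordinal.                               *)

Record ord := Ord {
  ord_sort :> Type;
  ord_le : rel ord_sort;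
  ord_wo : well_order ord_le }.

Section OrdSum.
Variables a b : ord.

Definition sum_le (x y : a + b) : bool :=
  match x, y with
  | inl x, inl y => ord_le x y
  | inl _, inr _ => true
  | inr _, inl _ => false
  | inr x, inr y => ord_le x y
  end.

Lemma sum_wo : well_order sum_le.
Proof.
move=> P [p Pp]; have [[x Px]|noL] := pselect (exists x, P (inl x)).
  have [|m [[Pm mP] mU]] := @ord_wo a (fun x => P (inl x)); first by exists x.
  exists (inl m); split=> [|[z|z] [Pz zP]].
  - by split=> // -[y|y] Py //=; apply: mP.
  - by congr inl; apply: mU; split=> // y Py; apply: (zP (inl y)).
  - by have := zP _ Pm.
have [|m [[Pm mP] mU]] := @ord_wo b (fun x => P (inr x)).
  by case: p Pp => z Pz; [case: noL; exists z | exists z].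
exists (inr m); split=> [|[z|z] [Pz zP]].
- by split=> // -[y|y] Py /=; [case: noL; exists y | apply: mP].
- by case: noL; exists z.
- by congr inr; apply: mU; split=> // y Py; apply: (zP (inr y)).
Qed.

Definition ord_add : ord := Ord sum_wo.

End OrdSum.

Lemma nat_wo : well_order leq.
Proof.
move=> P exP; have exP' : exists n, P n by case: exP => n Pn; exists n.
have [m Pm mP] := ex_minnP exP'; exists m; split=> [|z [Pz zP]].
  by split=> // y /mP.
by apply/eqP; rewrite eqn_leq mP // zP.
Qed.

Definition omega : ord := Ord nat_wo.

Record cylAlg (I : Type) := CylAlg {
  ca_disp : Order.disp_t;
  ca_sort :> ctbDistrLatticeType ca_disp;
  cyl : I -> ca_sort -> ca_sort;
  diag : I -> I -> ca_sort;
  cyl0 : forall i, cyl i \bot = \bot;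
  le_cyl : forall i x, x <= cyl i x;
  cylIcyl : forall i x y, cyl i (x `&` cyl i y) = cyl i x `&` cyl i y;
  cylC : forall i j x, cyl i (cyl j x) = cyl j (cyl i x);
  diagxx : forall i, diag i i = \top;
  diag_trans : forall k i j, k <> i -> k <> j ->
    diag i j = cyl k (diag i k `&` diag k j);
  cyl_diag : forall i j x, i <> j ->
    cyl i (diag i j `&` x) `&` cyl i (diag i j `&` ~` x) = \bot }.

Arguments diag {I c} : rename.

Section CylTheory.
Variables (I : Type) (A : cylAlg I).
Implicit Types (i j k : I) (x y : A).

Lemma cyl1 i : cyl i (\top : A) = \top.
Proof. by apply/eqP; rewrite -le1x le_cyl. Qed.

Lemma cyl_id i x : cyl i (cyl i x) = cyl i x.
Proof. by rewrite -[cyl i x in LHS]meet1x cylIcyl cyl1 meet1x. Qed.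

Lemma cylI_closed i x y :
  cyl i x = x -> cyl i y = y -> cyl i (x `&` y) = x `&` y.
Proof. by move=> xi yi; rewrite -[in LHS]yi cylIcyl xi yi. Qed.

Lemma cylN_closed i x : cyl i x = x -> cyl i (~` x) = ~` x.
Proof.
move=> xi; apply/le_anti; rewrite le_cyl andbT -disj_leC.
by rewrite -[X in _ `&` X]xi -cylIcyl xi meetCx cyl0.
Qed.

Lemma cylU_closed i x y :
  cyl i x = x -> cyl i y = y -> cyl i (x `|` y) = x `|` y.
Proof.
by move=> xi yi; rewrite -[x `|` y]complK complU; apply/cylN_closed/cylI_closed;
  apply: cylN_closed.
Qed.

Lemma cyl_diag_closed k i j : k <> i -> k <> j ->
  cyl k (diag i j : A) = diag i j.
Proof. by move=> ki kj; rewrite (diag_trans _ ki kj) cyl_id. Qed.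

End CylTheory.

Record subuniverse I (A : cylAlg I) (S : set A) : Prop := Subuniverse {
  sub0 : S \bot;
  sub1 : S \top;
  subI : forall x y, S x -> S y -> S (x `&` y);
  subU : forall x y, S x -> S y -> S (x `|` y);
  subN : forall x, S x -> S (~` x);
  sub_cyl : forall i x, S x -> S (cyl i x);
  sub_diag : forall i j, S (diag i j) }.

Definition Sg I (A : cylAlg I) (X : set A) : set A :=
  [set x | forall S, subuniverse S -> (X `<=` S)%classic -> S x]%classic.

Lemma Sg_subuniverse I (A : cylAlg I) (X : set A) : subuniverse (Sg X).
Proof.
split=> [S hS _|S hS _|x y Xx Xy S hS XS|x y Xx Xy S hS XS|x Xx S hS XS|
         i x Xx S hS XS|i j S hS _].
- exact: sub0.
- exact: sub1.
- by apply: subI => //; [apply: Xx | apply: Xy].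
- by apply: subU => //; [apply: Xx | apply: Xy].
- by apply: subN => //; apply: Xx.
- by apply: sub_cyl => //; apply: Xx.
- exact: sub_diag.
Qed.

Section Subalgebra.
Variables (I : Type) (A : cylAlg I) (S : set A) (hS : subuniverse S).

Definition sub_car of subuniverse S := set_type S.
Local Notation car := (sub_car hS).

HB.instance Definition _ := Choice.on car.

Definition in_sub (x : A) (Sx : S x) : car := exist _ x (mem_set Sx).

Lemma sub_valP (x : car) : S (val x). Proof. exact: set_valP. Qed.

Definition sub_bot : car := in_sub (sub0 hS).
Definition sub_top : car := in_sub (sub1 hS).
Definition sub_meet (x y : car) : car :=
  in_sub (subI hS (sub_valP x) (sub_valP y)).
Definition sub_join (x y : car) : car :=
  in_sub (subU hS (sub_valP x) (sub_valP y)).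
Definition sub_compl (x : car) : car := in_sub (subN hS (sub_valP x)).
Definition sub_le (x y : car) : bool := val x <= val y.
Definition sub_lt (x y : car) : bool := (y != x) && sub_le x y.

Fact sub_leE x y : sub_le x y = (sub_meet x y == x).
Proof. by rewrite /sub_le leEmeet -val_eqE. Qed.
Fact sub_ltE x y : sub_lt x y = (y != x) && sub_le x y. Proof. by []. Qed.
Fact sub_meetC : commutative sub_meet.
Proof. by move=> x y; apply: val_inj; apply: meetC. Qed.
Fact sub_joinC : commutative sub_join.
Proof. by move=> x y; apply: val_inj; apply: joinC. Qed.
Fact sub_meetA : associative sub_meet.
Proof. by move=> x y z; apply: val_inj; apply: meetA. Qed.
Fact sub_joinA : associative sub_join.
Proof. by move=> x y z; apply: val_inj; apply: joinA. Qed.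
Fact sub_joinKI y x : sub_meet x (sub_join x y) = x.
Proof. by apply: val_inj; apply: joinKI. Qed.
Fact sub_meetKU y x : sub_join x (sub_meet x y) = x.
Proof. by apply: val_inj; apply: meetKU. Qed.
Fact sub_meetUl : left_distributive sub_meet sub_join.
Proof. by move=> x y z; apply: val_inj; apply: meetUl. Qed.
Fact sub_meetxx : idempotent_op sub_meet.
Proof. by move=> x; apply: val_inj; apply: meetxx. Qed.

HB.instance Definition _ := Order.isMeetJoinDistrLattice.Build
  (ca_disp A) car sub_leE sub_ltE sub_meetC sub_joinC sub_meetA sub_joinA
  sub_joinKI sub_meetKU sub_meetUl sub_meetxx.

Fact sub_le0x (x : car) : sub_bot <= x. Proof. exact: le0x. Qed.
Fact sub_lex1 (x : car) : x <= sub_top. Proof. exact: lex1. Qed.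

HB.instance Definition _ := Order.hasBottom.Build (ca_disp A) car sub_le0x.
HB.instance Definition _ := Order.hasTop.Build (ca_disp A) car sub_lex1.

Fact sub_joinxC (x : car) : x `|` sub_compl x = \top.
Proof. by apply: val_inj; apply: joinxC. Qed.
Fact sub_meetxC (x : car) : x `&` sub_compl x = \bot.
Proof. by apply: val_inj; apply: meetxC. Qed.

HB.instance Definition _ := Order.TBDistrLattice_hasComplement.Build
  (ca_disp A) car sub_joinxC sub_meetxC.

Definition subalg : cylAlg I.
Proof.
refine (@CylAlg I (ca_disp A) car
  (fun i (x : car) => in_sub (sub_cyl hS i (sub_valP x)))
  (fun i j => in_sub (sub_diag hS i j)) _ _ _ _ _ _ _).
- by move=> i; apply: val_inj; apply: cyl0.
- by move=> i x; apply: le_cyl.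
- by move=> i x y; apply: val_inj; apply: cylIcyl.
- by move=> i j x; apply: val_inj; apply: cylC.
- by move=> i; apply: val_inj; apply: diagxx.
- by move=> k i j ki kj; apply: val_inj; apply: diag_trans.
- by move=> i j x ij; apply: val_inj; apply: cyl_diag.
Defined.

End Subalgebra.

Section Product.
Variables (I K : Type) (B : K -> cylAlg I).

Definition prod_car (B' : K -> cylAlg I) := forall k, B' k.
Local Notation car := (prod_car B).

HB.instance Definition _ := gen_eqMixin car.
HB.instance Definition _ := gen_choiceMixin car.

Definition prod_disp : Order.disp_t. Proof. exact: (Order.Disp tt tt). Qed.

Definition prod_bot : car := fun=> \bot.
Definition prod_top : car := fun=> \top.
Definition prod_meet (x y : car) : car := fun k => x k `&` y k.
Definition prod_join (x y : car) : car := fun k => x k `|` y k.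
Definition prod_compl (x : car) : car := fun k => ~` x k.
Definition prod_le (x y : car) : bool := `[< forall k, x k <= y k >].
Definition prod_lt (x y : car) : bool := (y != x) && prod_le x y.

Lemma prod_ext (x y : car) : (forall k, x k = y k) -> x = y.
Proof. exact: functional_extensionality_dep. Qed.

Fact prod_leE x y : prod_le x y = (prod_meet x y == x).
Proof.
apply/asboolP/eqP => [xy|xy k]; first by apply: prod_ext => k; apply/meet_l.
by rewrite -xy leIr.
Qed.
Fact prod_ltE x y : prod_lt x y = (y != x) && prod_le x y. Proof. by []. Qed.
Fact prod_meetC : commutative prod_meet.
Proof. by move=> x y; apply: prod_ext => k; apply: meetC. Qed.
Fact prod_joinC : commutative prod_join.
Proof. by move=> x y; apply: prod_ext => k; apply: joinC. Qed.
Fact prod_meetA : associative prod_meet.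
Proof. by move=> x y z; apply: prod_ext => k; apply: meetA. Qed.
Fact prod_joinA : associative prod_join.
Proof. by move=> x y z; apply: prod_ext => k; apply: joinA. Qed.
Fact prod_joinKI y x : prod_meet x (prod_join x y) = x.
Proof. by apply: prod_ext => k; apply: joinKI. Qed.
Fact prod_meetKU y x : prod_join x (prod_meet x y) = x.
Proof. by apply: prod_ext => k; apply: meetKU. Qed.
Fact prod_meetUl : left_distributive prod_meet prod_join.
Proof. by move=> x y z; apply: prod_ext => k; apply: meetUl. Qed.
Fact prod_meetxx : idempotent_op prod_meet.
Proof. by move=> x; apply: prod_ext => k; apply: meetxx. Qed.

HB.instance Definition _ := Order.isMeetJoinDistrLattice.Build
  prod_disp car prod_leE prod_ltE prod_meetC prod_joinC prod_meetA prod_joinA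
  prod_joinKI prod_meetKU prod_meetUl prod_meetxx.

Fact prod_le0x (x : car) : prod_bot <= x.
Proof. by apply/asboolP => k; apply: le0x. Qed.
Fact prod_lex1 (x : car) : x <= prod_top.
Proof. by apply/asboolP => k; apply: lex1. Qed.

HB.instance Definition _ := Order.hasBottom.Build prod_disp car prod_le0x.
HB.instance Definition _ := Order.hasTop.Build prod_disp car prod_lex1.

Fact prod_joinxC (x : car) : x `|` prod_compl x = \top.
Proof. by apply: prod_ext => k; apply: joinxC. Qed.
Fact prod_meetxC (x : car) : x `&` prod_compl x = \bot.
Proof. by apply: prod_ext => k; apply: meetxC. Qed.

HB.instance Definition _ := Order.TBDistrLattice_hasComplement.Build
  prod_disp car prod_joinxC prod_meetxC.

Definition prodalg : cylAlg I.
Proof.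
refine (@CylAlg I prod_disp car
  (fun i (x : car) => (fun k => cyl i (x k)) : car)
  (fun i j => (fun k => diag i j) : car) _ _ _ _ _ _ _).
- by move=> i; apply: prod_ext => k; apply: cyl0.
- by move=> i x; apply/asboolP => k; apply: le_cyl.
- by move=> i x y; apply: prod_ext => k; apply: cylIcyl.
- by move=> i j x; apply: prod_ext => k; apply: cylC.
- by move=> i; apply: prod_ext => k; apply: diagxx.
- by move=> l i j li lj; apply: prod_ext => k; apply: diag_trans.
- by move=> i j x ij; apply: prod_ext => k; apply: cyl_diag.
Defined.

End Product.

(* The base U may be empty: when I is nonempty, the algebra is then the       *)
(* one-element algebra, which is also the empty subdirect product.            *)
Section SetAlgebra.
Variables (I U : Type).
Implicit Types (s t : I -> U) (X Y : set (I -> U)).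
Local Open Scope classical_set_scope.

Definition agree_off (i : I) (s t : I -> U) := forall j, j <> i -> s j = t j.

Definition set_cyl (i : I) (X : set (I -> U)) : set (I -> U) :=
  [set s | exists2 t, X t & agree_off i s t].

Definition set_diag (i j : I) : set (I -> U) := [set s | s i = s j].

Lemma agree_off_sym i s t : agree_off i s t -> agree_off i t s.
Proof. by move=> st j /st. Qed.

Lemma agree_off_trans i s t r :
  agree_off i s t -> agree_off i t r -> agree_off i s r.
Proof. by move=> st tr j ji; rewrite st // tr. Qed.

Definition upd s (i : I) (u : U) : I -> U :=
  fun j => if pselect (j = i) then u else s j.

Lemma updE s i u : upd s i u i = u.
Proof. by rewrite /upd; case: pselect. Qed.

Lemma upd_neq s i u j : j <> i -> upd s i u j = s j.
Proof. by rewrite /upd; case: pselect. Qed.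

Lemma agree_off_upd i s u : agree_off i s (upd s i u).
Proof. by move=> j ji; rewrite upd_neq. Qed.

Lemma agree_offE i s t : agree_off i s t -> t = upd s i (t i).
Proof.
move=> st; apply: funext => j; rewrite /upd.
by case: pselect => /= [->//|ji]; rewrite st.
Qed.

Fact set_cylC_sub i j X : set_cyl i (set_cyl j X) `<=` set_cyl j (set_cyl i X).
Proof.
have [->//|ij] := pselect (i = j).
move=> s [t [r Xr tr] st]; exists (upd s j (r j)); last exact: agree_off_upd.
exists r => // k ki; have [->|kj] := pselect (k = j); first by rewrite updE.
by rewrite upd_neq // st // tr.
Qed.

Definition setalg : cylAlg I.
Proof.
refine (@CylAlg I set_display (set (I -> U)) set_cyl set_diag _ _ _ _ _ _ _).
- by move=> i; apply/seteqP; split=> // s [].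
- by move=> i X; apply/asboolP => s Xs; exists s.
- move=> i X Y; apply/seteqP; split=> s.
    move=> [t [Xt [r Yr tr]] st]; split; first by exists t.
    by exists r => //; apply: agree_off_trans tr.
  move=> [[t Xt st] [r Yr sr]]; exists t => //; split=> //; exists r => //.
  exact: agree_off_trans (agree_off_sym st) sr.
- by move=> i j X; apply/seteqP; split; apply: set_cylC_sub.
- by move=> i; apply/seteqP.
- move=> k i j ki kj; apply/seteqP; split=> s.
    move=> sij; exists (upd s k (s i)); last exact: agree_off_upd.
    by split; rewrite /set_diag /= updE upd_neq 1?eq_sym //; apply/nesym.
  move=> [t [/= tik tkj] st]; rewrite /set_diag /= st; last exact/nesym.
  by rewrite tik tkj -st //; apply/nesym.
- move=> i j X ij; apply/seteqP; split=> // s [[t [tij Xt] st] [r [rij nXr] sr]].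
  apply: nXr; suff -> : r = t by [].
  rewrite (agree_offE st) (agree_offE sr).
  by rewrite tij rij -(st j) ?(sr j)//; apply/nesym.
Defined.

End SetAlgebra.

Record is_hom I (A B : cylAlg I) (f : A -> B) : Prop := IsHom {
  hom0 : f \bot = \bot;
  hom1 : f \top = \top;
  homI : forall x y, f (x `&` y) = f x `&` f y;
  homU : forall x y, f (x `|` y) = f x `|` f y;
  homN : forall x, f (~` x) = ~` f x;
  hom_cyl : forall i x, f (cyl i x) = cyl i (f x);
  hom_diag : forall i j, f (diag i j) = diag i j }.

Definition isomorphic I (A B : cylAlg I) : Prop :=
  exists2 f : A -> B, is_hom f & bijective f.

Definition subdirect I K (B : K -> cylAlg I) (S : set (prodalg B)) : Prop :=
  subuniverse S /\ forall k (b : B k), exists2 x, S x & x k = b.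

Definition representable I (A : cylAlg I) : Prop :=
  exists (K : Type) (U : K -> Type)
    (T : forall k, set (setalg I (U k))) (hT : forall k, subuniverse (T k))
    (S : set (prodalg (fun k => subalg (hT k)))) (hS : subdirect S),
  isomorphic A (subalg hS.1).

Lemma id_is_hom I (A : cylAlg I) : is_hom (@id A).
Proof. by []. Qed.

Lemma comp_is_hom I (A B C : cylAlg I) (g : B -> C) (f : A -> B) :
  is_hom g -> is_hom f -> is_hom (g \o f).
Proof.
move=> hg hf; split=> /=.
- by rewrite (hom0 hf) (hom0 hg).
- by rewrite (hom1 hf) (hom1 hg).
- by move=> x y; rewrite (homI hf) (homI hg).
- by move=> x y; rewrite (homU hf) (homU hg).
- by move=> x; rewrite (homN hf) (homN hg).
- by move=> i x; rewrite (hom_cyl hf) (hom_cyl hg).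
- by move=> i j; rewrite (hom_diag hf) (hom_diag hg).
Qed.

Lemma range_subuniverse I (A B : cylAlg I) (f : A -> B) :
  is_hom f -> subuniverse (range f).
Proof.
move=> hf; split.
- by exists \bot; rewrite ?(hom0 hf).
- by exists \top; rewrite ?(hom1 hf).
- by move=> _ _ [x _ <-] [y _ <-]; exists (x `&` y); rewrite ?(homI hf).
- by move=> _ _ [x _ <-] [y _ <-]; exists (x `|` y); rewrite ?(homU hf).
- by move=> _ [x _ <-]; exists (~` x); rewrite ?(homN hf).
- by move=> i _ [x _ <-]; exists (cyl i x); rewrite ?(hom_cyl hf).
- by move=> i j; exists (diag i j); rewrite ?(hom_diag hf).
Qed.

Lemma val_is_hom I (A : cylAlg I) (S : set A) (hS : subuniverse S) :
  is_hom (val : subalg hS -> A).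
Proof. by []. Qed.

Lemma proj_is_hom I K (B : K -> cylAlg I) k :
  is_hom (fun x : prodalg B => x k).
Proof. by []. Qed.

Lemma embed_representable I (A : cylAlg I) K (U : K -> Type)
    (f : forall k, A -> setalg I (U k)) :
    (forall k, is_hom (f k)) ->
    (forall x y, (forall k, f k x = f k y) -> x = y) ->
  representable A.
Proof.
move=> hf finj; pose hT k := range_subuniverse (hf k).
pose B k := subalg (hT k).
have fT k x : range (f k) (f k x) by exists x.
pose g (x : A) : prodalg B := fun k => in_sub (hT k) (fT k x).
have hg : is_hom g.
  split=> [||x y|x y|x|i x|i j]; apply: functional_extensionality_dep => k;
    apply: val_inj.
  - exact: (hom0 (hf k)). - exact: (hom1 (hf k)). - exact: (homI (hf k)).
  - exact: (homU (hf k)). - exact: (homN (hf k)). - exact: (hom_cyl (hf k)).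
  - exact: (hom_diag (hf k)).
have gS x : range g (g x) by exists x.
have hS : subdirect (range g).
  split=> [|k [b bP]]; first exact: range_subuniverse.
  have [x _ xb] := set_mem bP; exists (g x) => //; exact: val_inj.
exists K, U, (fun k => range (f k)), hT, (range g), hS.
exists (fun x => in_sub hS.1 (gS x)).
  by split=> [||x y|x y|x|i x|i j]; apply: val_inj => /=;
    rewrite ?(hom0 hg) ?(hom1 hg) ?(homI hg) ?(homU hg) ?(homN hg)
            ?(hom_cyl hg) ?(hom_diag hg).
rewrite -setTT_bijective; split=> //.
  move=> x y _ _ /(congr1 val)/= gxy; apply: finj => k.
  by have /(congr1 val) := congr1 (fun z : prodalg B => z k) gxy.
move=> [y yP] _; have [x _ xy] := set_mem yP; exists x => //; exact: val_inj.
Qed.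

Lemma representable_embed I (A : cylAlg I) : representable A ->
  exists (K : Type) (U : K -> Type) (f : forall k, A -> setalg I (U k)),
    (forall k, is_hom (f k)) /\
    (forall x y, (forall k, f k x = f k y) -> x = y).
Proof.
move=> [K [U [T [hT [S [hS [f hf fbij]]]]]]].
exists K, U, (fun k x => val (val (f x) k)); split=> [k|x y fxy].
  split=> [||x y|x y|x|i x|i j].
  - by rewrite (hom0 hf). - by rewrite (hom1 hf). - by rewrite (homI hf).
  - by rewrite (homU hf). - by rewrite (homN hf). - by rewrite (hom_cyl hf).
  - by rewrite (hom_diag hf).
apply: (bij_inj fbij); apply: val_inj.
by apply: functional_extensionality_dep => k; apply: val_inj; apply: fxy.
Qed.

(* For ordinals alpha <= beta, beta is isomorphic to alpha + gamma for a      *)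
(* unique gamma; I stands for alpha and J for beta \ alpha.                   *)
Section NeatReduct.
Variables (I J : Type).

Definition reduct (A : cylAlg (I + J)) : cylAlg I.
Proof.
refine (@CylAlg I (ca_disp A) (ca_sort A) (fun i => cyl (inl i))
  (fun i j => diag (inl i) (inl j)) _ _ _ _ _ _ _).
- by move=> i; apply: cyl0.
- by move=> i x; apply: le_cyl.
- by move=> i x y; apply: cylIcyl.
- by move=> i j x; apply: cylC.
- by move=> i; apply: diagxx.
- by move=> k i j ki kj; apply: diag_trans; move=> [].
- by move=> i j x ij; apply: cyl_diag; move=> [].
Defined.

Definition nr_set (A : cylAlg (I + J)) : set A :=
  [set x | forall j : J, cyl (inr j) x = x]%classic.
Arguments nr_set : clear implicits.

Lemma nr_subuniverse (A : cylAlg (I + J)) :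
  subuniverse (nr_set A : set (reduct A)).
Proof.
split=> [j|j|x y xj yj j|x y xj yj j|x xj j|i x xj j|i1 i2 j].
- exact: cyl0.
- exact: cyl1.
- exact: cylI_closed.
- exact: cylU_closed.
- exact: cylN_closed.
- by rewrite /= cylC xj.
- exact: cyl_diag_closed.
Qed.

Definition nr (A : cylAlg (I + J)) : cylAlg I := subalg (nr_subuniverse A).

Lemma nr_representable (A : cylAlg (I + J)) :
  representable A -> representable (nr A).
Proof.
move=> /representable_embed[K [U [f [hf finj]]]].
pose glue V (t : J -> V) (s : I -> V) (i : I + J) :=
  match i with inl i => s i | inr j => t j end.
pose K' := {k : K & J -> U k}.
pose g (k : K') (x : nr A) : setalg I (U (tag k)) :=
  [set s | f (tag k) (val x) (glue _ (tagged k) s)]%classic.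
apply: (@embed_representable _ _ K' (fun k => U (tag k)) g).
  move=> [k t]; rewrite /g /=; split=> /= [||x y|x y|x|i x|i j].
  - by rewrite (hom0 (hf k)).
  - by rewrite (hom1 (hf k)).
  - by rewrite (homI (hf k)).
  - by rewrite (homU (hf k)).
  - by rewrite (homN (hf k)).
  - rewrite (hom_cyl (hf k)); apply/seteqP; split=> s /= [r xr sr].
      exists (fun i => r (inl i)) => [|i' i'i]; last first.
        by rewrite -(sr (inl i')) // => -[].
      rewrite /=; congr (f k (val x) _): xr; apply: funext => -[//|j] /=.
      by rewrite -(sr (inr j)).
    exists (glue _ t r) => // -[i'|//] ii /=; apply: sr => ei.
    by apply: ii; rewrite ei.
  - by rewrite (hom_diag (hf k)).
move=> x y gxy; apply/val_inj/finj => k; apply: funext => s.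
have /(congr1 (fun X : set (I -> U k) => X (fun i => s (inl i)))) :=
  gxy (existT _ k (fun j => s (inr j))).
by rewrite /g /=; congr (f k (val x) _ = f k (val y) _); apply: funext => -[].
Qed.

End NeatReduct.

Arguments nr_set {I J} A _.

Record category := Category {
  Ob :> Type;
  Hom : Ob -> Ob -> Type;
  idm : forall a, Hom a a;
  compm : forall a b c, Hom b c -> Hom a b -> Hom a c;
  comp1m : forall a b (f : Hom a b), compm (idm b) f = f;
  compm1 : forall a b (f : Hom a b), compm f (idm a) = f;
  compmA : forall a b c d (h : Hom c d) (g : Hom b c) (f : Hom a b),
    compm h (compm g f) = compm (compm h g) f }.

Arguments Hom {c} : rename.
Arguments idm {c} : rename.

Record functor (K L : category) := Functor {
  fob :> K -> L;
  fmap : forall a b : K, Hom a b -> Hom (fob a) (fob b);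
  fmap1 : forall a, fmap (idm a) = idm (fob a);
  fmapM : forall a b c (g : Hom b c) (f : Hom a b),
    fmap (compm g f) = compm (fmap g) (fmap f) }.

Definition universal_map (K L : category) (G : functor K L) (B : L)
    (A : K) (u : Hom B (G A)) : Prop :=
  forall (A' : K) (f : Hom B (G A')),
    exists! g : Hom A A', compm (fmap G g) u = f.

Definition has_universal_map (K L : category) (G : functor K L) (B : L) : Prop :=
  exists (A : K) (u : Hom B (G A)), universal_map u.

Definition full_subcat (C : category) (P : C -> Prop) : category :=
  @Category {a : C | P a} (fun a b => Hom (sval a) (sval b))
    (fun a => idm (sval a)) (fun a b c => @compm C _ _ _)
    (fun a b => @comp1m C _ _) (fun a b => @compm1 C _ _)
    (fun a b c d => @compmA C _ _ _ _).

Definition restrict (C D : category) (P : C -> Prop) (Q : D -> Prop)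
    (G : functor C D) (PQ : forall a, P a -> Q (G a)) :
  functor (full_subcat P) (full_subcat Q) :=
  @Functor (full_subcat P) (full_subcat Q)
    (fun a => exist Q (G (sval a)) (PQ _ (svalP a)))
    (fun a b => @fmap _ _ G (sval a) (sval b))
    (fun a => fmap1 G (sval a)) (fun a b c => @fmapM _ _ G _ _ _).

Record embedding I (A B : cylAlg I) := Embedding {
  emb_fun :> A -> B;
  emb_hom : is_hom emb_fun;
  emb_inj : injective emb_fun }.

Lemma emb_ext I (A B : cylAlg I) (f g : embedding A B) : f =1 g -> f = g.
Proof.
case: f g => [f hf fi] [g hg gi] /= /funext fg; case: g / fg hg gi => hg gi.
by congr Embedding; apply: Prop_irrelevance.
Qed.

Definition emb_id I (A : cylAlg I) : embedding A A :=
  Embedding (id_is_hom A) (@inj_id A).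

Definition emb_comp I (A B C : cylAlg I) (g : embedding B C)
    (f : embedding A B) : embedding A C :=
  Embedding (comp_is_hom (emb_hom g) (emb_hom f))
    (inj_comp (@emb_inj _ _ _ g) (@emb_inj _ _ _ f)).

Definition CA (I : Type) : category.
Proof.
by refine (@Category (cylAlg I) (@embedding I) (@emb_id I) (@emb_comp I) _ _ _);
  move=> *; apply: emb_ext.
Defined.

Section NeatFunctor.
Variables (I J : Type).

Lemma nr_emb_subproof (A B : cylAlg (I + J)) (f : embedding A B) (x : nr A) :
  nr_set B (f (val x)).
Proof. by move=> j; rewrite -(hom_cyl (emb_hom f)) (sub_valP x j). Qed.

Definition nr_emb (A B : cylAlg (I + J)) (f : embedding A B) :
  embedding (nr A) (nr B).
Proof.
pose hf := emb_hom f.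
refine (@Embedding _ (nr A) (nr B)
  (fun x => in_sub (nr_subuniverse B) (nr_emb_subproof f x)) _ _).
- split=> [||x y|x y|x|i x|i j]; apply: val_inj.
  + exact: (hom0 hf). + exact: (hom1 hf).
  + exact: (homI hf (val x) (val y)). + exact: (homU hf (val x) (val y)).
  + exact: (homN hf (val x)). + exact: (hom_cyl hf (inl i) (val x)).
  + exact: (hom_diag hf (inl i) (inl j)).
- by move=> x y /(congr1 val)/= /emb_inj/val_inj.
Defined.

Definition nr_functor : functor (CA (I + J)) (CA I).
Proof.
refine (@Functor (CA (I + J)) (CA I) (@nr I J) nr_emb _ _).
- by move=> A; apply: emb_ext => x; apply: val_inj.
- by move=> A B C g f; apply: emb_ext => x; apply: val_inj.
Defined.

End NeatFunctor.

Definition RCA (I : Type) : category :=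
  full_subcat (@representable I : CA I -> Prop).

Definition nr_generated I J (A : cylAlg (I + J)) : Prop :=
  Sg (nr_set A) = setT.

Definition L_obj I J (A : cylAlg (I + J)) : Prop :=
  representable A /\ nr_generated A.

Definition L (alpha : ord) : category :=
  full_subcat (@L_obj alpha omega : CA (ord_add alpha omega) -> Prop).

Definition Nr (alpha : ord) : functor (L alpha) (RCA alpha) :=
  @restrict (CA (ord_add alpha omega)) (CA alpha) (@L_obj alpha omega)
    (@representable alpha) (nr_functor alpha omega)
    (fun A hA => nr_representable hA.1).

(* Main.v *)
Require Import Defs.
From mathcomp Require Import all_boot all_order.
From mathcomp Require Import boolp classical_sets functions cardinality.

(** Suppose that [B] has a universal map with target [C], and that [B] embeds
    both by [f] and by [g] into the neat reduct of one algebra [A] of L. Then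
    [f] and [g] both factor through injective homomorphisms [C -> A], so a term
    of the larger signature, evaluated at the image of an element [x] of [B],
    is zero along [f] iff it is zero in [C] iff it is zero along [g]. It is
    therefore enough to find [B], [x], [f], [g] and a term which separates the
    two: the spare dimensions see something that the representation of [B]
    can still vary. Such data are given by [incompatible_dilations].

    Take the base [U = I + nat], with [I] the dimension, and call a sequence
    in [I -> U] a finite variant if it differs from [inl] at finitely many
    places. Let [V false] consist of the [inl a], and let [V true] have the
    one further point [inr 0]. In world [c], the element [x] is the set of
    injective finite variants with values in [V c]. Fix such a sequence and
    free one coordinate: by counting, exactly one point of [V false] can be put
    back ([inner_inj_unique]), while in [V true] there may be two
    ([inner_inj_inl], [inner_inj_upd]). Two spare dimensions suffice to
    express by a term that two distinct points fit ([two_fillers]).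

    The dimensions in [I] alone cannot tell the two worlds apart. Relate
    finite variants of the two worlds when they have the same equalities
    between coordinates and the same coordinates in [V c], and relate any other
    sequence to itself. This is a bisimulation ([twin_bisimulation]): a finite
    variant, with one coordinate freed, always misses a point of [V false],
    again by counting ([finvar_fresh_inl]), so a fresh value of either kind
    can be matched in the other world. For any bisimulation, the pairs of sets
    that respect it form an algebra on which both projections are injective
    ([coordinate]). This algebra is [B]; its two projections, followed by the
    passage from a set to the cylinder over it, give [f] and [g]. *)

Set Implicit Arguments.
Unset Strict Implicit.
Unset Printing Implicit Defensive.

Import Order.Theory.
Local Open Scope order_scope.

(** * Set algebras invariant under a bisimulation *)

Section Bisimulation.
Variables (I K : Type) (U : K -> Type).
Variable R : forall c d, (I -> U c) -> (I -> U d) -> Prop.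

(** Equivalence of sequences for the first-order language whose variables are
    indexed by [I]: moving one coordinate is a quantifier step. By symmetry,
    [bisim_eq] gives equal kernels and [bisim_forth] also goes back. *)
Record bisimulation : Prop := Bisimulation {
  bisim_sym : forall c d (s : I -> U c) (t : I -> U d), R s t -> R t s;
  bisim_eq : forall c d (s : I -> U c) (t : I -> U d), R s t ->
    forall i j, s i = s j -> t i = t j;
  bisim_forth : forall c d (s : I -> U c) (t : I -> U d), R s t ->
    forall i u, exists v, R (upd s i u) (upd t i v);
  bisim_total : forall c d (s : I -> U c), exists t : I -> U d, R s t }.

Definition invariant : set (prodalg (fun c => setalg I (U c))) :=
  [set x | forall c d (s : I -> U c) (t : I -> U d), R s t -> x c s -> x d t]%classic.

Hypothesis hR : bisimulation.

(** Cylindrifications are where [bisim_forth] is used: a witness changes one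
    coordinate of [s], and the same change can be matched in [t]. *)
Lemma invariant_subuniverse : subuniverse invariant.
Proof.
split.
- by move=> c d s t _ [].
- by [].
- by move=> x y xR yR c d s t st [xs ys]; split; [apply: xR st xs|apply: yR st ys].
- by move=> x y xR yR c d s t st [xs|ys]; [left; apply: xR st xs|right; apply: yR st ys].
- move=> x xR c d s t st; change (~ x c s -> ~ x d t) => nxs xt; apply: nxs.
  exact: xR (bisim_sym hR st) xt.
- move=> i x xR c d s t st [r xr sr].
  have [v rv] := bisim_forth hR st i (r i).
  exists (upd t i v); last exact: agree_off_upd.
  by apply: xR rv _; rewrite -(agree_offE sr).
- by move=> i j c d s t st; apply: bisim_eq st i j.
Qed.

Definition invariant_alg : cylAlg I := subalg invariant_subuniverse.

Lemma coordinate_hom c :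
  is_hom (fun x : invariant_alg => val x c : setalg I (U c)).
Proof. by []. Qed.

(** By totality, a family of sets that respects [R] is determined by any one of
    its members. *)
Lemma coordinate_inj c :
  injective (fun x : invariant_alg => val x c : setalg I (U c)).
Proof.
suff le (x y : invariant_alg) d : val x c = val y c -> (val x d `<=` val y d)%classic.
  by move=> x y xy; apply: val_inj; apply: prod_ext => d;
    apply/seteqP; split; apply: le.
move=> xy t xt; have [s ts] := bisim_total hR c t.
apply: (sub_valP y) (bisim_sym hR ts) _; rewrite -xy.
exact: (sub_valP x) ts xt.
Qed.

Definition coordinate c : embedding invariant_alg (setalg I (U c)) :=
  Embedding (coordinate_hom c) (@coordinate_inj c).

Lemma invariant_representable : representable invariant_alg.
Proof.
apply: (embed_representable coordinate_hom) => x y xy.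
by apply: val_inj; apply: prod_ext.
Qed.

End Bisimulation.

(** * Dilations and a term with spare dimensions *)

Section Dilation.
Variables (I J : Type).

Section Generated.
Variable A : cylAlg (I + J).

Definition nr_span : cylAlg (I + J) := subalg (Sg_subuniverse (nr_set A)).

(** Generation inside the subalgebra follows from generation in [A]: the image
    in [A] of a subuniverse of [nr_span] is a subuniverse of [A]. *)
Lemma nr_span_generated : nr_generated nr_span.
Proof.
apply/seteqP; split=> // x _ S hS nrS.
pose T := [set a : A | exists2 y : nr_span, S y & val y = a]%classic.
have hT : subuniverse T.
  split.
  - by exists \bot; [exact: sub0 hS|].
  - by exists \top; [exact: sub1 hS|].
  - by move=> _ _ [y Sy <-] [z Sz <-]; exists (y `&` z); [exact: subI|].
  - by move=> _ _ [y Sy <-] [z Sz <-]; exists (y `|` z); [exact: subU|].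
  - by move=> _ [y Sy <-]; exists (~` y); [exact: subN|].
  - by move=> i _ [y Sy <-]; exists (cyl i y); [exact: sub_cyl|].
  - by move=> i j; exists (diag i j); [exact: sub_diag|].
have [|y Sy /val_inj <- //] := (sub_valP x : Sg (nr_set A) (val x)) T hT.
move=> a nra; have aA : Sg (nr_set A) a by move=> ? _; apply.
exists (in_sub (Sg_subuniverse (nr_set A)) aA) => //.
by apply: nrS => j; apply: val_inj; apply: nra.
Qed.

Lemma nr_in_Sg (x : nr A) : Sg (nr_set A) (val x).
Proof. by move=> S _; apply; apply: sub_valP. Qed.

Lemma nr_in_span (x : nr A) :
  nr_set nr_span (in_sub (Sg_subuniverse (nr_set A)) (nr_in_Sg x)).
Proof. by move=> j; apply: val_inj; apply: (sub_valP x). Qed.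

Definition nr_incl : embedding (nr A) (nr nr_span).
Proof.
refine (@Embedding _ (nr A) (nr nr_span) (fun x =>
  in_sub (nr_subuniverse nr_span) (nr_in_span x)) _ _).
- by split=> [||x y|x y|x|i x|i j]; apply: val_inj; apply: val_inj.
- by move=> x y /(congr1 (fun z : nr nr_span => val (val z))) /= /val_inj.
Defined.

End Generated.

Section Cylinder.
Variables (U : Type) (u0 : U).

Definition cylinder (X : set (I -> U)) : set (I + J -> U) :=
  [set s : I + J -> U | X (s \o inl)]%classic.

Lemma cylinder_nr (X : setalg I U) :
  nr_set (setalg (I + J) U) (cylinder X).
Proof.
move=> j; apply/seteqP; split=> s; last by exists s.
case=> t Xt st; rewrite /cylinder /=; congr X: Xt.
by apply: funext => i /=; rewrite -st.
Qed.

Lemma upd_inl (s : I + J -> U) i u : upd s (inl i) u \o inl = upd (s \o inl) i u.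
Proof.
apply: funext => j; have [<-|ij] /= := pselect (i = j); first by rewrite !updE.
by rewrite !upd_neq // => [/nesym|[/nesym]].
Qed.

(** The point [u0] is only there to extend a sequence on [I] to one on
    [I + J], so that distinct sets have distinct cylinders. *)
Definition dilation : embedding (setalg I U) (nr (setalg (I + J) U)).
Proof.
refine (@Embedding _ (setalg I U) (nr (setalg (I + J) U))
  (fun X => in_sub (nr_subuniverse _) (cylinder_nr X)) _ _).
- split=> [||X Y|X Y|X|i X|i j]; apply: val_inj => //=.
  apply/seteqP; split=> s.
    case=> t Xt st; exists (upd s (inl i) (t i)); last exact: agree_off_upd.
    by rewrite /cylinder /= upd_inl -(agree_offE st).
  case=> t Xt st; exists (t \o inl) => // j ji /=.
  by rewrite st // => -[].
- move=> X Y /(congr1 val) /= XY; apply/funext => s.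
  pose r (i : I + J) := if i is inl i then s i else u0.
  by change (cylinder X r = cylinder Y r); rewrite XY.
Defined.

End Cylinder.

(** Substitution of [inr k] for [inl i] in the sense of cylindric algebras; see
    [fill_cylinder]. *)
Definition fill (A : cylAlg (I + J)) i (k : J) (x : A) : A :=
  cyl (inl i) (diag (inl i) (inr k) `&` x).

(** In a set algebra: the values at [inr k] and [inr l] are distinct and both
    can be put at place [i] so as to land in [x]. *)
Definition two_fillers (A : cylAlg (I + J)) i (k l : J) (x : A) : A :=
  (fill i k x `&` fill i l x) `&` ~` diag (inr k) (inr l).

Lemma hom_two_fillers (A B : cylAlg (I + J)) (f : A -> B) i k l x :
  is_hom f -> f (two_fillers i k l x) = two_fillers i k l (f x).
Proof.
move=> hf; rewrite /two_fillers /fill !(homI hf) (homN hf) !(hom_cyl hf).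
by rewrite !(homI hf) !(hom_diag hf).
Qed.

Lemma fill_cylinder U i k (X : set (I -> U)) (s : I + J -> U) :
  fill i k (cylinder X : setalg (I + J) U) s <-> X (upd (s \o inl) i (s (inr k))).
Proof.
rewrite -upd_inl; split=> [[t [/= tik Xt] st]|Xs].
  by rewrite (agree_offE st) tik -st in Xt.
exists (upd s (inl i) (s (inr k))); last exact: agree_off_upd.
by split=> //; rewrite /= /set_diag /= updE upd_neq.
Qed.

End Dilation.

(** * Two worlds that the original dimensions cannot separate *)

Section FiniteVariants.
Variable I : eqType.
Local Notation U := (I + nat)%type.
Implicit Types (s t : I -> U) (i j a : I) (c d : bool).

Inductive finvar : (I -> U) -> Prop :=
| finvar_inl : finvar inl
| finvar_upd s i u : finvar s -> finvar (upd s i u).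

Lemma upd_undo s i u : upd (upd s i u) i (s i) = s.
Proof. by apply/esym/(@agree_offE _ _ i)=> j ji; rewrite upd_neq. Qed.

Lemma finvar_support s : finvar s ->
  exists F : seq I, forall j, j \notin F -> s j = inl j.
Proof.
elim=> [|{}s i u _ [F sF]]; first by exists [::].
exists (i :: F) => j; rewrite inE negb_or => /andP[/eqP ji jF].
by rewrite upd_neq // sF.
Qed.

(** Let [F] be a finite set with [i] in [F], off which [s] is [inl]. The
    #|F| points [inl a] with [a] in [F] can only be values of [s] at [F], and
    there are #|F| - 1 places in [F] other than [i]. *)
Lemma finvar_fresh_inl s i : finvar s ->
  exists a, forall j, j <> i -> s j <> inl a.
Proof.
move=> /finvar_support[F0 sF0]; pose F := undup (i :: F0).
have sF j : j \notin F -> s j = inl j.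
  by rewrite mem_undup inE negb_or => /andP[_ /sF0].
have iF : i \in F by rewrite mem_undup mem_head.
apply: contrapT => nofresh.
have hit a : exists2 j, j <> i & s j = inl a.
  apply: contrapT => nohit; apply: nofresh; exists a => j ji sj.
  by apply: nohit; exists j.
have : (size (map (@inl I nat) F) <= size (map s (rem i F)))%N.
  apply: uniq_leq_size; first by rewrite map_inj_uniq ?undup_uniq // => ? ? [].
  move=> _ /mapP[a aF ->]; have [j ji sj] := hit a; rewrite -sj map_f //.
  rewrite (rem_filter _ (undup_uniq _)) mem_filter /=; apply/andP; split; first exact/eqP.
  by apply: contraT => jF; move: (sF _ jF); rewrite sj => -[aj]; rewrite -aj aF in jF.
rewrite !size_map size_rem //; case: (F) iF => //= b F' _.
by rewrite ltnn.
Qed.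

Lemma finvar_fresh_inr s : finvar s -> exists n, forall j, s j <> inr n.+1.
Proof.
move=> fs; suff [m sm] : exists m, forall j n, s j = inr n -> (n <= m)%N.
  by exists m => j /sm; rewrite ltnn.
elim: fs => [|{}s i u _ [m sm]]; first by exists 0.
exists (maxn m (if u is inr n then n else 0)) => j n.
rewrite leq_max; have [->|ji] := pselect (j = i).
  by rewrite updE => ->; rewrite leqnn orbT.
by rewrite upd_neq // => /sm ->.
Qed.

(** The set [V c] of the introduction; its complement is infinite, hence never
    exhausted by a finite variant ([finvar_fresh_inr]). *)
Definition inner c : set U :=
  [set u | if u is inr n then c /\ n = 0 else True]%classic.

(** An injective finite variant with values in [V false] is an injective self-map
    of [I] with finite support, hence onto: it maps the support into itself. *)
Lemma finvar_onto s a : finvar s -> injective s -> (forall j, inner false (s j)) ->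
  exists j, s j = inl a.
Proof.
move=> /finvar_support[F0 sF0] s_inj s_inl; pose F := undup F0.
have sF j : j \notin F -> s j = inl j by rewrite mem_undup; apply: sF0.
have [aF|/sF] := boolP (a \in F); last by exists a.
have sub : {subset map s F <= map (@inl I nat) F}.
  move=> _ /mapP[j jF ->]; move: (s_inl j); case sj : (s j) => [b|n]; last by case.
  move=> _; rewrite map_f //; apply: contraT => bF.
  by rewrite -(sF _ bF) in sj; rewrite -(s_inj _ _ sj) jF in bF.
have [||_ sFE] := uniq_min_size _ sub.
- by rewrite map_inj_uniq ?undup_uniq.
- by rewrite !size_map.
have : inl a \in map s F by rewrite sFE map_f.
by case/mapP => j _ ->; exists j.
Qed.

(** On sequences that are not finite variants the two worlds coincide, so there
    the identity is enough. *)
Definition twin c d s t : Prop :=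
  (~ finvar s /\ s = t) \/
  [/\ finvar s, finvar t, forall i j, s i = s j <-> t i = t j &
      forall i, inner c (s i) <-> inner d (t i)].

(** A new value [u] which already occurs at another place is copied from there;
    otherwise it is matched by a value which is fresh in [t] and lies in [V d]
    iff [u] lies in [V c]. *)
Lemma twin_forth c d s t : twin c d s t ->
  forall i u, exists v, twin c d (upd s i u) (upd t i v).
Proof.
case=> [[ns <-] i u|[fs ft ker col] i u].
  exists u; left; split=> // fu; apply: ns; rewrite -(upd_undo s i u).
  exact: finvar_upd.
suff [v [uv keruv]] : exists v, (inner c u <-> inner d v) /\
    forall j, j <> i -> (s j = u <-> t j = v).
  exists v; right; split; [exact: finvar_upd|exact: finvar_upd| |].
  - move=> a b; have [->|ai] := pselect (a = i).
      have [->|bi] := pselect (b = i); rewrite ?updE ?upd_neq //.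
      by split=> /esym/(keruv _ bi)/esym.
    have [->|bi] := pselect (b = i); rewrite ?updE ?upd_neq //.
    exact: keruv.
  - by move=> j; have [->|ji] := pselect (j = i); rewrite ?updE ?upd_neq.
have [[j [ji <-]]|fresh] := pselect (exists j, j <> i /\ s j = u).
  by exists (t j).
have freshu j : j <> i -> s j <> u by move=> ji sj; apply: fresh; exists j.
have [cu|ncu] := pselect (inner c u).
  have [a ta] := finvar_fresh_inl i ft; exists (inl a); split=> // j ji.
  by split=> [/(freshu _ ji)|/(ta _ ji)].
have [n tn] := finvar_fresh_inr ft; exists (inr n.+1); split=> [|j ji].
  by split=> // -[].
by split=> [/(freshu _ ji)|/tn].
Qed.

Lemma twin_bisimulation :
  @bisimulation I bool (fun=> U) twin.
Proof.
split=> [c d s t|c d s t|c d s t|c d s].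
- case=> [[ns <-]|[fs ft ker col]]; first by left.
  by right; split=> // [i j|i]; split; by [move/ker | move/col].
- by case=> [[_ <-]|[_ _ ker _]] i j // /ker.
- exact: twin_forth.
have [fs|ns] := pselect (finvar s); last by exists s; left.
(* [inl] is related to itself, and a finite variant is reached from it by
   finitely many changes of one coordinate, each matched by [twin_forth]. *)
elim: fs => [|{}s i u _ [t st]].
  by exists inl; right; split=> //; exact: finvar_inl.
by have [v stv] := twin_forth st i u; exists (upd t i v).
Qed.

Definition inner_inj : prodalg (fun _ : bool => setalg I U) :=
  fun c => [set s | [/\ finvar s, injective s & forall j, inner c (s j)]]%classic.

Lemma inner_inj_invariant : invariant (twin : forall c d, _) inner_inj.
Proof.
move=> c d s t st [fs s_inj sc]; case: st => [[]//|[_ ft ker col]].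
by split=> [//|i j /ker/s_inj//|j]; apply/col.
Qed.

(** If [v] differed from [u], then by [finvar_onto] it would be the value of
    [upd s i u] at some place other than [i], and [upd s i v] would take it
    twice. *)
Lemma inner_inj_unique s i u v :
  inner_inj false (upd s i u) -> inner_inj false (upd s i v) -> u = v.
Proof.
case=> fu u_inj uc [_ v_inj vc].
have := vc i; rewrite updE; case: v v_inj {vc} => [a v_inj _|n _ []//].
have [j] := finvar_onto a fu u_inj uc.
have [->|ji] := pselect (j = i); first by rewrite updE.
rewrite upd_neq // => sj; case: (ji); apply: v_inj.
by rewrite updE upd_neq.
Qed.

Lemma inner_inj_inl : inner_inj true inl.
Proof. by split=> // [|i j []//]; exact: finvar_inl. Qed.

Lemma inner_inj_upd i : inner_inj true (upd inl i (inr 0)).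
Proof.
split; first exact/finvar_upd/finvar_inl.
  move=> a b; have [->|ai] := pselect (a = i).
    by have [->|bi] := pselect (b = i); rewrite ?updE ?upd_neq.
  by have [->|bi] := pselect (b = i); rewrite ?updE ?upd_neq // => -[].
by move=> j; have [->|ji] := pselect (j = i); rewrite ?updE ?upd_neq.
Qed.

(** The generated algebra [nr_span D] does not depend on the world, so both
    embeddings have the same target. *)
Lemma incompatible_dilations (J : Type) (k l : J) (i : I) : k <> l ->
  exists (B : cylAlg I) (A : cylAlg (I + J)) (f g : embedding B (nr A)) (x : B),
    [/\ representable B, L_obj A, two_fillers i k l (val (f x)) = \bot &
        two_fillers i k l (val (g x)) <> \bot].
Proof.
move=> kl; pose D := setalg (I + J) U; pose A := nr_span D.
pose f c : embedding (invariant_alg twin_bisimulation) (nr A) :=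
  emb_comp (nr_incl D)
    (emb_comp (dilation I J (inr 0 : U)) (coordinate twin_bisimulation c)).
pose x : invariant_alg twin_bisimulation :=
  in_sub (invariant_subuniverse twin_bisimulation) inner_inj_invariant.
have fE c : val (two_fillers i k l (val (f c x))) =
    two_fillers i k l (cylinder (inner_inj c) : D).
  exact: hom_two_fillers (val_is_hom _).
exists (invariant_alg twin_bisimulation), A, (f false), (f true), x; split.
- exact: invariant_representable.
- split; last exact: nr_span_generated.
  apply: (@embed_representable _ A unit (fun=> U) (fun=> val : A -> D)) => [_|y z yz].
    exact: val_is_hom.
  by apply: val_inj; apply: (yz tt).
- apply: val_inj; rewrite fE; apply/seteqP; split=> // s [[]].
  move=> /fill_cylinder sk /fill_cylinder sl; apply.
  exact: inner_inj_unique sk sl.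
(* Place [i] of [inl] can be filled by its own value [inl i] or by the extra
   point [inr 0]; store these two values in the spare places [k] and [l]. *)
- pose s (j : I + J) : U := match j with
    inl j => inl j | inr j => if pselect (j = k) then inl i else inr 0 end.
  move=> /(congr1 val); rewrite fE => E.
  suff : two_fillers i k l (cylinder (inner_inj true) : D) s by rewrite E.
  have si : s \o inl = inl by [].
  have sk : s (inr k) = inl i by rewrite /s; case: pselect.
  have sl : s (inr l) = inr 0 by rewrite /s; case: pselect => // lk; case: kl.
  split; first split.
  + apply/fill_cylinder; rewrite si sk -(@agree_offE _ _ i inl inl) //.
    exact: inner_inj_inl.
  + apply/fill_cylinder; rewrite si sl; exact: inner_inj_upd.
  + by change (s (inr k) <> s (inr l)); rewrite sk sl.
Qed.

End FiniteVariants.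

Theorem corollary38 (alpha : ord)
    (alpha_infinite : infinite_set [set: alpha]%classic) :
  ~ (forall B : RCA alpha, has_universal_map (Nr alpha) B).
Proof.
have [i _] := infinite_setN0 alpha_infinite.
have [B [A [f [g [x [repB LA f0 g0]]]]]] :=
  @incompatible_dilations {classic alpha} nat 0 1 i (@O_S 0).
move=> /(_ (exist _ B repB))[[C LC] [u univ]]; apply: g0.
have [f' [f'u _]] := univ (exist _ A LA) f.
have [g' [g'u _]] := univ (exist _ A LA) g.
pose y := two_fillers i 0 1 (val (u x)).
have y0 : y = \bot.
  apply: (@emb_inj _ _ _ f'); rewrite (hom0 (emb_hom f')).
  rewrite hom_two_fillers; last exact: emb_hom.
  by rewrite -[RHS]f0 -f'u.
rewrite -g'u /= -(hom_two_fillers _ _ _ _ (emb_hom g')).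
by rewrite -/y y0 (hom0 (emb_hom g')).
Qed.
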